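(* For every $n\in\mathbb{N}$ and every integer $d$ with $1\le d\le \sqrt{n}/3$, there exist a connected planar graph $G_d$ on $n$ vertices, vertices $u,v$ of $G_d$ with $d(u,v)=d$, and a deterministic root-choice rule for Algorithm KPR, such that for every integer $R>2d$, Algorithm KPR run on $G_d$ with parameter $R$ and this root-choice rule never separates $u$ and $v$ (i.e. $u$ and $v$ lie in the same output cluster with probability $1$).
   Context: Let $G=(V,E)$ be a connected unweighted planar graph and $d(\cdot,\cdot)$ its shortest-path distance. Two vertices are separated by a (random) partition of $V$ if they lie in different parts. Algorithm KPR with integer parameter $R\ge 1$: set $F=\emptyset$. For each of three phases $i=1,2,3$: for each connected component $C$ of the graph $(V,E\setminus F)$ (the components being those present at the start of the phase), choose a root $r\in C$, define the level of $x\in C$ as its distance from $r$ within $C$, sample $k$ uniformly from $\{0,1,\dots,R-1\}$ (independently), and add to $F$ every edge of $C$ joining a vertex at level $\ell$ to a vertex at level $\ell+1$ with $\ell\equiv k \pmod R$. Output the connected components of $(V,E\setminus F)$ as the clusters. A root-choice rule specifies, for each component $C$ encountered, which vertex of $C$ is used as its root. *)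

(* Defs.v *)
From mathcomp Require Import all_boot.
Set Implicit Arguments. Unset Strict Implicit. Unset Printing Implicit Defensive.

Section Graphs.
Variable T : finType.

Definition simple_graph (e : rel T) : Prop := symmetric e /\ irreflexive e.

Definition connected_graph (e : rel T) : Prop := forall x y : T, connect e x y.

Definition walk (r : rel T) (x y : T) (k : nat) : bool :=
  [exists p : k.-tuple T, path r x p && (last x p == y)].

Definition is_dist (r : rel T) (x y : T) (k : nat) : bool :=
  walk r x y k && [forall j : 'I_k, ~~ walk r x y j].

Notation dart e := {p : T * T | e p.1 p.2 && e p.2 p.1}.

Lemma dart_rev_proof (e : rel T) (d : dart e) :
  e (val d).2 (val d).1 && e (val d).1 (val d).2.
Proof. by case: d => [[a b]] /= /andP [h1 h2]; rewrite h1 h2. Qed.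

Definition drev (e : rel T) (d : dart e) : dart e :=
  exist _ ((val d).2, (val d).1) (dart_rev_proof d).

Definition rotation_system (e : rel T) (sigma : dart e -> dart e) : Prop :=
  injective sigma /\
  (forall d, (val (sigma d)).1 = (val d).1) /\
  (forall d d', (val d).1 = (val d').1 -> exists k, iter k sigma d = d').

(* Planarity of a CONNECTED graph: it has no edge, or it admits a rotation
   system of genus 0, i.e. one whose faces (orbits of d |-> sigma (rev d))
   satisfy Euler's formula  V - E + F = 2. *)
Definition planar_connected (e : rel T) : Prop :=
  #|{: dart e}| = 0 \/
  exists sigma : dart e -> dart e,
    rotation_system sigma /\
    #|T| + fcard (fun d => sigma (drev d)) predT = (#|{: dart e}|)./2 + 2.

Definition comp (r : rel T) (x : T) : {set T} := [set y | connect r x y].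

Definition restrict (r : rel T) (C : {set T}) : rel T :=
  [rel a b | (a \in C) && (b \in C) && r a b].

Definition valid_rule (rule : {set T} -> rel T -> T) : Prop :=
  forall (C : {set T}) (g : rel T), C != set0 -> rule C g \in C.

Definition cut_edge (R : nat) (r : rel T) (rt : T) (k : nat) (x y : T) : bool :=
  [exists l : 'I_#|T|.+1,
     is_dist r rt x l && is_dist r rt y l.+1 && (l %% R == k)].

(* One phase of KPR: ks C is the offset sampled for component C. *)
Definition kpr_phase (R : nat) (rule : {set T} -> rel T -> T)
    (ks : {set T} -> 'I_R) (r : rel T) : rel T :=
  fun x y =>
    let C := comp r x in
    let rt := rule C (restrict r C) in
    r x y && ~~ cut_edge R r rt (ks C) x y && ~~ cut_edge R r rt (ks C) y x.

(* Three phases; the output clusters are the components of the final graph. *)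
Definition kpr (R : nat) (rule : {set T} -> rel T -> T)
    (ks1 ks2 ks3 : {set T} -> 'I_R) (e : rel T) : rel T :=
  kpr_phase rule ks3 (kpr_phase rule ks2 (kpr_phase rule ks1 e)).

End Graphs.
Arguments kpr {T} R rule ks1 ks2 ks3 e.
Arguments kpr_phase {T} R rule ks r.

(* Main.v *)
(** The graph is the grid on a sphere: 2d - 1 parallels, each a cycle of 2d + 1
    vertices, joined along meridians of length 2d between two poles; surplus
    vertices are leaves at the north pole.  The vertices u and v lie on the
    equator, at columns a and -a modulo 2d + 1 with a = ceil(d/2).

    Rooted at a pole of a component containing a whole hemisphere, the equator
    lies in one level and is never cut.  Such a phase either leaves the
    hemisphere whole or cuts it off completely, and since R > 2d, when both
    hemispheres are whole at most one is cut off.  So a pole is available for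
    the first two phases.  If both poles have been cut off before the third
    phase, the component is an annulus around an intact equator; it is rooted
    at column 0 of the equator, where the level of a column is its distance to 0
    on the cycle.  A cut at level k < a spares the arc from u to v away from the
    root, and a cut at level k >= a spares the arc through the root. *)

Require Import Defs.
From mathcomp Require Import all_boot zify.
Set Implicit Arguments. Unset Strict Implicit. Unset Printing Implicit Defensive.

(** * Walks and levels *)

Section Walks.
Variables (T : finType) (r : rel T).

Lemma walkP x y k :
  reflect (exists p, [/\ size p = k, path r x p & last x p = y]) (walk r x y k).
Proof.
apply: (iffP existsP) => [[p /andP [hp /eqP hl]]|[p [hs hp hl]]].
  by exists p; rewrite size_tuple.
by exists (Tuple (introT eqP hs)); rewrite /= hp hl eqxx.
Qed.

Lemma walk0 x y : walk r x y 0 = (x == y).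
Proof.
apply/walkP/eqP => [[p [/size0nil -> _ //]]|->]; by exists [::].
Qed.

Lemma walkS x z k :
  reflect (exists2 y, walk r x y k & r y z) (walk r x z k.+1).
Proof.
apply: (iffP (walkP _ _ _)) => [[p]|[y /walkP [p [hs hp hl]] yz]].
  case/lastP: p => [[//]|p w]; rewrite size_rcons rcons_path last_rcons.
  move=> [[hs] /andP [hp hr] <-]; exists (last x p) => //.
  by apply/walkP; exists p.
by exists (rcons p z); rewrite size_rcons hs rcons_path hp hl yz last_rcons.
Qed.

Lemma is_distI x y k :
  walk r x y k -> (forall l, walk r x y l -> k <= l) -> is_dist r x y k.
Proof.
move=> hk hmin; rewrite /is_dist hk; apply/forallP => j; apply/negP => /hmin.
by rewrite leqNgt ltn_ord.
Qed.

Lemma is_dist_uniq x y k l : is_dist r x y k -> is_dist r x y l -> k = l.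
Proof.
move=> /andP [wk /forallP mk] /andP [wl /forallP ml].
case: (ltngtP k l) => // h.
- by have := ml (Ordinal h); rewrite wk.
- by have := mk (Ordinal h); rewrite wl.
Qed.

Lemma walk_cat x y z k l : walk r x y k -> walk r y z l -> walk r x z (k + l).
Proof.
move=> wxy; elim: l z => [|l IH] z; first by rewrite walk0 addn0 => /eqP <-.
by case/walkS => w /IH wxw wz; rewrite addnS; apply/walkS; exists w.
Qed.

Lemma walk_connect x y k : walk r x y k -> connect r x y.
Proof. by case/walkP => p [_ hp <-]; apply/connectP; exists p. Qed.

Lemma connect_ind (P : T -> Prop) x :
  P x -> (forall a b, connect r x a -> P a -> r a b -> P b) ->
  forall y, connect r x y -> P y.
Proof.
move=> Px step y /connectP [p].
elim/last_ind: p y => [y _ -> //|p w IH y].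
rewrite rcons_path last_rcons => /andP [hp hr] ->.
apply: step hr; last exact: IH.
by apply/connectP; exists p.
Qed.

(** A potential rising by at most one per edge bounds walk lengths from below; this certifies the
    levels used later. The condition concerns only the component of [x], because ring distance
    violates it at the poles. *)
Lemma walk_lip (f : T -> nat) x y k :
  (forall a b, connect r x a -> r a b -> f b <= (f a).+1) ->
  walk r x y k -> f y <= f x + k.
Proof.
move=> lip; elim: k y => [|k IH] y; first by rewrite walk0 => /eqP ->; rewrite addn0.
case/walkS => w hw hr; have := lip _ _ (walk_connect hw) hr; have := IH _ hw; lia.
Qed.

End Walks.

(** * One phase on the component of [u] *)

Section Phase.
Variables (T : finType) (r : rel T) (u : T) (R : nat).
Variables (rule : {set T} -> rel T -> T) (ks : {set T} -> 'I_R).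
Hypothesis r_sym : symmetric r.

Let rt := rule (Defs.comp r u) (restrict r (Defs.comp r u)).
Let k := ks (Defs.comp r u).
Let r' := kpr_phase R rule ks r.

Lemma comp_eq x : connect r u x -> Defs.comp r x = Defs.comp r u.
Proof.
move=> ux; apply/setP => y; rewrite !inE.
by rewrite (same_connect (sym_connect_sym r_sym) ux).
Qed.

Lemma phaseE x y : connect r u x ->
  r' x y = r x y && ~~ cut_edge R r rt k x y && ~~ cut_edge R r rt k y x.
Proof. by move=> ux; rewrite /r' /kpr_phase comp_eq. Qed.

Lemma phase_sub : subrel r' r.
Proof. by move=> x y /andP [/andP []]. Qed.

Lemma phase_sym : symmetric r'.
Proof.
suff imp x y : r' x y -> r' y x by move=> x y; apply/idP/idP; apply: imp.
rewrite /r' /kpr_phase => /andP [/andP [rxy h1] h2].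
have -> : Defs.comp r y = Defs.comp r x.
  apply/setP => z; rewrite !inE.
  by rewrite (same_connect (sym_connect_sym r_sym) (connect1 rxy)).
by rewrite r_sym rxy h1 h2.
Qed.

Lemma phase_connect x y : connect r' x y -> connect r x y.
Proof. by apply: connect_sub => a b /phase_sub /connect1. Qed.

Lemma not_cut x y lx ly : is_dist r rt x lx -> is_dist r rt y ly ->
  (ly = lx.+1 -> lx %% R <> k) -> ~~ cut_edge R r rt k x y.
Proof.
move=> hx hy hk; apply/negP => /existsP [l /andP [/andP [hl hl'] /eqP hlk]].
have e1 := is_dist_uniq hl hx; have e2 := is_dist_uniq hl' hy.
by apply: hk; rewrite -?e1 -?e2.
Qed.

Lemma phase_keep x y lx ly : connect r u x -> r x y ->
  is_dist r rt x lx -> is_dist r rt y ly ->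
  (ly = lx.+1 -> lx %% R <> k) -> (lx = ly.+1 -> ly %% R <> k) -> r' x y.
Proof.
move=> ux rxy hx hy h1 h2; rewrite phaseE // rxy /=.
by rewrite (not_cut hx hy h1) (not_cut hy hx h2).
Qed.

(** The bound on [k] is there because [cut_edge] looks for levels only up to [#|T|]. *)
Lemma phase_cut x y : connect r u x -> k <= #|T| ->
  is_dist r rt x k -> is_dist r rt y k.+1 -> r' x y = false.
Proof.
move=> ux kT hx hy; rewrite phaseE //; apply/negP => /andP [/andP [_ /negP h] _].
apply: h; apply/existsP; exists (Ordinal (kT : k < #|T|.+1)).
by rewrite /= hx hy modn_small ?eqxx.
Qed.

End Phase.

(** * Three phases on a sphere *)

Section Hemispheres.
Variables (T : finType) (e : rel T) (d : nat).
Hypothesis d_gt0 : 0 < d.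

(* [c i j] is the vertex in row [i] and column [j], for [j] arbitrary: row [0] is
   the pole.  Vertices outside the range of [c] (leaves) are allowed. *)
Record polar (row : T -> nat) (c : nat -> nat -> T) : Prop := Polar {
  row_lip : forall x y, e x y -> row y <= (row x).+1;
  row_c : forall i j, i <= 2 * d -> row (c i j) = i;
  c_pole : forall j, c 0 j = c 0 0;
  c_edge : forall x y, e x y -> row y = (row x).+1 ->
    exists j, x = c (row x) j /\ y = c (row y) j }.

Definition flip_row (row : T -> nat) x := 2 * d - row x.
Definition flip (c : nat -> nat -> T) i := c (2 * d - i).

(** This symmetry lets each statement about the north pole serve for the south pole. *)
Lemma polar_flip row c : symmetric e -> (forall x, row x <= 2 * d) ->
  (forall j, c (2 * d) j = c (2 * d) 0) ->
  polar row c -> polar (flip_row row) (flip c).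
Proof.
move=> e_sym row_le pole [lip rc _ edge]; split.
- by move=> x y; rewrite e_sym /flip_row => /lip; lia.
- by move=> i j hi; rewrite /flip_row /flip rc; lia.
- by move=> j; rewrite /flip subn0.
- move=> x y; rewrite e_sym /flip_row /flip => exy h.
  have hx := row_le x; have hy := row_le y.
  have [|j [-> ->]] := edge _ _ exy; first by lia.
  by exists j; rewrite !rc; [split; congr c; lia|lia|lia].
Qed.

(** Meridian edges alone suffice: they give every vertex of the hemisphere a walk from the pole as
    long as its row number. *)
Definition intact (r : rel T) (c : nat -> nat -> T) :=
  forall i j, i < d -> r (c i j) (c i.+1 j).

(* Restricted to the component of [u], since each component has its own cuts. *)
Definition cut_off (r : rel T) (u : T) (row : T -> nat) :=
  exists2 k, k < d & forall x y, connect r u x -> row x = k -> row y = k.+1 ->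
    r x y = false.

Definition equator (r : rel T) (c : nat -> nat -> T) :=
  forall j, r (c d j) (c d j.+1).

(** * A phase rooted at a pole *)

Section Pole.
Variables (row : T -> nat) (c : nat -> nat -> T) (r : rel T) (a : nat).
Hypothesis pol : polar row c.
Hypothesis r_sym : symmetric r.
Hypothesis r_e : subrel r e.
Hypothesis eqr : equator r c.
Let u := c d a.

Lemma connect_equator j : connect r u (c d j).
Proof.
have c0 : connect r (c d 0) (c d j).
  by elim: j => // j IH; apply: connect_trans IH (connect1 (eqr j)).
apply: connect_trans c0; rewrite (sym_connect_sym r_sym) /u.
by elim: (a) => // j' IH; apply: connect_trans IH (connect1 (eqr j')).
Qed.

(** Rows change by at most one along an edge, so a walk from the equator down to row [k] would need
    an edge between rows [k + 1] and [k], and none is left. *)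
Lemma cut_off_row k :
  (forall x y, connect r u x -> row x = k -> row y = k.+1 -> r x y = false) ->
  k < d -> forall x, connect r u x -> k < row x.
Proof.
move=> hcut kd; apply: connect_ind => [|x y ux hx rxy].
  by rewrite (row_c pol) //; lia.
have ryx : r y x by rewrite r_sym.
have := row_lip pol (r_e ryx); case: (ltngtP k (row y)) => // [|ky]; first by lia.
move=> h; rewrite (hcut y x) // in ryx; last by lia.
exact: connect_trans ux (connect1 rxy).
Qed.

Lemma cut_off_pole : cut_off r u row -> ~~ connect r u (c 0 0).
Proof.
case=> k kd hcut; apply/negP => /(cut_off_row hcut kd).
by rewrite (row_c pol).
Qed.

Hypothesis int : intact r c.

Lemma walk_column i j : i <= d -> walk r (c 0 0) (c i j) i.
Proof.
elim: i => [|i IH] hi; first by rewrite walk0 (c_pole pol).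
by apply/walkS; exists (c i j); [apply: IH; lia|apply: int].
Qed.

Lemma connect_column i j : i <= d -> connect r u (c i j).
Proof.
have up i' j' : i' <= d -> connect r (c 0 0) (c i' j').
  by move=> hi; apply: walk_connect (walk_column j' hi).
move=> hi; apply: connect_trans (up _ _ hi).
by rewrite (sym_connect_sym r_sym) up.
Qed.

Lemma dist_column i j : i <= 2 * d -> walk r (c 0 0) (c i j) i ->
  is_dist r (c 0 0) (c i j) i.
Proof.
move=> hi w; apply: is_distI => // l /(walk_lip (f := row)) h.
have /h : forall x y, connect r (c 0 0) x -> r x y -> row y <= (row x).+1.
  by move=> x y _ /r_e /(row_lip pol).
by rewrite !(row_c pol).
Qed.

Lemma flip_step i j : intact r (flip c) -> d <= i < 2 * d -> r (c i j) (c i.+1 j).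
Proof.
move=> int2 hi; rewrite r_sym; have := int2 (2 * d - i.+1) j; rewrite /flip.
have -> : 2 * d - (2 * d - i.+1) = i.+1 by lia.
have -> : 2 * d - (2 * d - i.+1).+1 = i by lia.
by apply; lia.
Qed.

Lemma walk_full_column i j : intact r (flip c) -> i <= 2 * d ->
  walk r (c 0 0) (c i j) i.
Proof.
move=> int2; case: (leqP i d) => [id _|]; first exact: walk_column.
elim: i => // i IH di hi; apply/walkS; exists (c i j); last by apply: flip_step => //; lia.
case: (ltngtP i d) => [h|h|->].
- by move: di; rewrite ltnS leqNgt h.
- by apply: IH => //; apply: ltnW.
- exact: walk_column.
Qed.

Variables (R : nat) (rule : {set T} -> rel T -> T) (ks : {set T} -> 'I_R).
Hypothesis T_big : 2 * d <= #|T|.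
Hypothesis R_big : 2 * d < R.
Hypothesis root_pole : rule (Defs.comp r u) (restrict r (Defs.comp r u)) = c 0 0.
Let k := ks (Defs.comp r u).
Let r' := kpr_phase R rule ks r.

Lemma pole_equator : equator r' c.
Proof.
have D j : is_dist r (c 0 0) (c d j) d by apply: dist_column (walk_column _ _) => //; lia.
move=> j; apply: (@phase_keep _ r u) (connect_equator j) (eqr j) _ _ _ _ => //.
- by rewrite root_pole; apply: D.
- by rewrite root_pole; apply: D.
- by lia.
- by lia.
Qed.

Lemma column_keep i j : i < 2 * d -> i != k -> connect r u (c i j) ->
  r (c i j) (c i.+1 j) -> walk r (c 0 0) (c i j) i -> r' (c i j) (c i.+1 j).
Proof.
move=> hi ik ui ri wi.
have wi1 : walk r (c 0 0) (c i.+1 j) i.+1 by apply/walkS; exists (c i j).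
apply: (@phase_keep _ r u _ _ _ _ _ _ i i.+1) => //.
- by rewrite root_pole; apply: dist_column => //; lia.
- by rewrite root_pole; apply: dist_column => //; lia.
(* Since [i < 2 * d < R], reduction modulo [R] is trivial and only level [k] is cut. *)
- by move=> _; rewrite modn_small; [apply/eqP|lia].
- by lia.
Qed.

Lemma column_cut x y : k < 2 * d -> connect r u x -> row x = k -> row y = k.+1 ->
  (forall j, walk r (c 0 0) (c k j) k) ->
  (forall j, walk r (c 0 0) (c k.+1 j) k.+1) -> r' x y = false.
Proof.
move=> kd ux xk yk w1 w2; apply/negP => r'xy.
have /r_e exy := phase_sub r'xy.
have [|j []] := c_edge pol exy; first by rewrite xk yk.
rewrite xk yk => hx hy; move: r'xy.
rewrite /r' (@phase_cut _ r u) //.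
- by rewrite -/k; lia.
- by rewrite root_pole hx; apply: dist_column => //; rewrite -/k; lia.
- by rewrite root_pole hy; apply: dist_column => //; rewrite -/k; lia.
Qed.

(** Edges from the pole to the equator start at levels below [d]: an offset [k >= d] misses them
    all, while [k < d] cuts every meridian at the same row. *)
Lemma pole_near : if d <= k then intact r' c else cut_off r' u row.
Proof.
case: (leqP d k) => hk.
  move=> i j hi; apply: column_keep; [lia|lia| | |].
  - by apply: connect_column; lia.
  - exact: int.
  - by apply: walk_column; lia.
exists k => // x y /phase_connect ux xk yk.
by apply: column_cut => // [|j|j]; [lia|apply: walk_column; lia..].
Qed.

(** Edges of the far hemisphere start at levels [d] to [2 * d - 1]. This range is disjoint from the
    one in [pole_near], so one offset never cuts off both hemispheres. *)
Lemma pole_far : intact r (flip c) ->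
  if d <= k < 2 * d then cut_off r' u (flip_row row) else intact r' (flip c).
Proof.
move=> int2; case: ifP => hk.
  (* Counted from the far pole, the gap between rows [k] and [k + 1] lies between rows
     [2 * d - k - 1] and [2 * d - k]. *)
  exists (2 * d - k.+1) => [|x y /phase_connect ux]; first by lia.
  rewrite /flip_row => xk yk.
  rewrite /r' (phase_sym rule ks r_sym) -/r'; apply/negP => h.
  have ryx := phase_sub h.
  have : r' y x = false; last by rewrite h.
  have lip := row_lip pol (r_e ryx).
  apply: column_cut => [||||j|j].
  - by lia.
  - by apply: connect_trans ux (connect1 _); rewrite r_sym.
  - by lia.
  - by lia.
  - by apply: walk_full_column => //; lia.
  - by apply: walk_full_column => //; lia.
move=> i j hi; rewrite /r' (phase_sym rule ks r_sym) -/r' /flip.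
have -> : 2 * d - i = (2 * d - i.+1).+1 by lia.
have w i' : i' <= 2 * d -> walk r (c 0 0) (c i' j) i' by apply: walk_full_column.
apply: column_keep; [lia|lia| | |apply: w; lia].
- apply: connect_trans (walk_connect (w _ _)); last by lia.
  by apply: connect_column.
- by apply: flip_step => //; lia.
Qed.

End Pole.
End Hemispheres.

Section Sphere.
Variables (T : finType) (e : rel T) (d : nat).
Hypothesis d_gt0 : 0 < d.
Let m := (2 * d).+1.

(** With truncated subtraction, [p - q + (q - p)] is the absolute difference; the whole is the
    distance on a cycle of length [m]. *)
Definition ring_dist p q := minn (p - q + (q - p)) (m - (p - q + (q - p))).

Lemma ring_dist_triangle p q s : p < m -> q < m -> s < m ->
  ring_dist p s <= ring_dist p q + ring_dist q s.
Proof. by rewrite /ring_dist; lia. Qed.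

Variables (row col : T -> nat) (c : nat -> nat -> T).
Hypothesis e_sym : symmetric e.
Hypothesis pol : polar e d row c.
Hypothesis row_le : forall x, row x <= 2 * d.
Hypothesis south_pole : forall j, c (2 * d) j = c (2 * d) 0.
Hypothesis e_column : forall i j, i < 2 * d -> e (c i j) (c i.+1 j).
Hypothesis e_equator : equator d e c.
Hypothesis c_period : c d m = c d 0.
Hypothesis col_c : forall j, j < m -> col (c d j) = j.
Hypothesis col_lt : forall x, col x < m.
Hypothesis col_lip : forall x y, e x y -> 0 < row x < 2 * d ->
  0 < row y < 2 * d -> ring_dist (col x) (col y) <= 1.

Let a := uphalf d.
Let u := c d a.
Let v := c d (m - a).
Let N := c 0 0.
Let S := c (2 * d) 0.
Let z := c d 0.

Lemma walk_east (r : rel T) j l : equator d r c -> walk r (c d j) (c d (j + l)) l.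
Proof.
move=> eqr; elim: l => [|l IH]; first by rewrite addn0 walk0.
by apply/walkS; exists (c d (j + l)) => //; rewrite addnS; apply: eqr.
Qed.

Lemma walk_west (r : rel T) j l : symmetric r -> equator d r c ->
  walk r (c d (j + l)) (c d j) l.
Proof.
move=> r_sym eqr; elim: l j => [|l IH] j; first by rewrite addn0 walk0.
apply/walkS; exists (c d j.+1); first by rewrite addnS -addSn.
by rewrite r_sym; apply: eqr.
Qed.

Lemma half_bounds : a <= d /\ d <= 2 * a <= d.+1.
Proof. by rewrite /a; have := odd_double_half d; rewrite uphalf_half; case: odd; lia. Qed.

(** Only through a pole could a walk jump between columns, and the bound on rows shows that fewer
    than [d] steps from the equator do not reach one. *)
Lemma walk_near k y : walk e u y k -> k < d ->
  (d <= row y + k) && (row y <= d + k) && (ring_dist a (col y) <= k).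
Proof.
have [ad _] := half_bounds.
elim: k y => [|k IH] y.
  rewrite walk0 => /eqP <- _; rewrite (row_c pol) ?col_c /ring_dist; rewrite /m; lia.
case/walkS => x wx exy kd.
have {wx IH}/andP [/andP [h1 h2] h3] := IH x wx (ltnW kd).
have l1 := row_lip pol exy.
have l2 : row x <= (row y).+1 by apply: (row_lip pol); rewrite e_sym.
have l3 : ring_dist (col x) (col y) <= 1 by apply: col_lip => //; lia.
have := @ring_dist_triangle a (col x) (col y) _ (col_lt x) (col_lt y).
rewrite /m; lia.
Qed.

Lemma dist_uv : is_dist e u v d.
Proof.
have [ad /andP [da ad']] := half_bounds.
apply: is_distI => [|l w].
  (* For even [d] the arc through column 0 has length [2 * a = d]; for odd [d] the other arc has
     length [m - 2 * a = d]. *)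
  case: (ltngtP d (2 * a)) => [h|h|h]; last 1 first.
  - have w1 := walk_west 0 a e_sym e_equator.
    have := walk_west (m - a) a e_sym e_equator.
    rewrite subnK ?c_period; last by rewrite /m; lia.
    by move/(walk_cat w1); rewrite addnn -mul2n -h.
  - have := walk_east a (m - a - a) e_equator.
    by rewrite /u /v subnKC; [have -> : m - a - a = d by rewrite /m; lia|rewrite /m; lia].
  - lia.
rewrite leqNgt; apply/negP => ld; have /andP [_] := walk_near w ld.
rewrite col_c /ring_dist /m; lia.
Qed.

(** * The third phase, rooted on the equator *)

Section LastPhase.
Variables (r : rel T) (R : nat).
Variables (rule : {set T} -> rel T -> T) (ks : {set T} -> 'I_R).
Hypothesis R_big : 2 * d < R.
Hypothesis r_sym : symmetric r.
Hypothesis r_e : subrel r e.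
Hypothesis eqr : equator d r c.
Hypothesis cutN : cut_off d r u row.
Hypothesis cutS : cut_off d r u (flip_row d row).
Hypothesis root_z : rule (Defs.comp r u) (restrict r (Defs.comp r u)) = z.
Let k := ks (Defs.comp r u).
Let r' := kpr_phase R rule ks r.

Lemma band_row x : connect r u x -> 0 < row x < 2 * d.
Proof.
have pol' := polar_flip d_gt0 e_sym row_le south_pole pol.
have u' : u = flip d c d a by rewrite /u /flip; congr c; lia.
move=> ux.
case: cutN => k1 k1d h1; case: cutS => k2 k2d h2.
have /= b1 := cut_off_row d_gt0 pol r_sym r_e h1 k1d ux.
have := cut_off_row d_gt0 pol' r_sym r_e (a := a) (k := k2).
rewrite -u' => /(_ h2 k2d x ux); rewrite /flip_row; lia.
Qed.

(** The potential is the ring distance to column 0: by [band_row] the component avoids both poles,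
    so columns have no shortcut. Allowing [j = m], again column 0, lets arcs close up at the
    seam. *)
Lemma level_z j : j <= m -> is_dist r z (c d j) (minn j (m - j)).
Proof.
move=> jm; have zE : c d m = z by [].
have hz : connect r u z by apply: connect_equator.
apply: is_distI => [|l].
  case: (leqP j d) => jd.
    rewrite (_ : minn j (m - j) = j); first by have := walk_east 0 j eqr; rewrite add0n.
    by rewrite /m; lia.
  rewrite (_ : minn j (m - j) = m - j); last by rewrite /m; lia.
  by have := walk_west j (m - j) r_sym eqr; rewrite subnKC ?zE.
have lip x y : connect r z x -> r x y ->
    ring_dist 0 (col y) <= (ring_dist 0 (col x)).+1.
  move=> zx rxy; have ux := connect_trans hz zx.
  have bx := band_row ux.
  have bY := band_row (connect_trans ux (connect1 rxy)).
  have := col_lip (r_e rxy) bx bY.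
  have := @ring_dist_triangle 0 (col x) (col y) _ (col_lt x) (col_lt y).
  rewrite /m; lia.
move/(walk_lip lip).
case: (ltngtP j m) jm => // [jm _|-> _].
  by rewrite /z !col_c // /ring_dist /m; lia.
by rewrite zE /z !col_c // /ring_dist /m; lia.
Qed.

Lemma equator_keep j : j < m ->
  (minn j.+1 (m - j.+1) = (minn j (m - j)).+1 -> minn j (m - j) <> k) ->
  (minn j (m - j) = (minn j.+1 (m - j.+1)).+1 -> minn j.+1 (m - j.+1) <> k) ->
  r' (c d j) (c d j.+1).
Proof.
move=> jm h1 h2.
apply: (@phase_keep _ r u _ _ _ r_sym _ _ (minn j (m - j)) (minn j.+1 (m - j.+1))).
- exact: connect_equator.
- exact: eqr.
- by rewrite root_z; apply: level_z; lia.
- by rewrite root_z; apply: level_z; lia.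
- by rewrite modn_small //; rewrite /m; lia.
- by rewrite modn_small //; rewrite /m; lia.
Qed.

Lemma connect_arc i l : (forall j, i <= j < i + l -> r' (c d j) (c d j.+1)) ->
  connect r' (c d i) (c d (i + l)).
Proof.
elim: l => [|l IH] h; first by rewrite addn0.
rewrite addnS; apply: connect_trans (connect1 (h _ _)); last by lia.
by apply: IH => j hj; apply: h; lia.
Qed.

(* If [k < a], the arc away from [z] has levels in [k + 1, k + R]; otherwise the
   arc through [z] has levels at most [k]. *)
Lemma last_phase : connect r' u v.
Proof.
have [ad /andP [da ad']] := half_bounds.
have r'_sym := sym_connect_sym (phase_sym rule ks r_sym).
case: (ltnP k a) => ka.
  have -> : v = c d (a + (m - a - a)) by rewrite /v; congr c; rewrite /m; lia.
  apply: connect_arc => j hj; apply: equator_keep; rewrite /m in hj *; lia.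
apply: (@connect_trans _ _ z).
  rewrite r'_sym; apply: (@connect_arc 0 a) => j hj.
  by apply: equator_keep; rewrite /m; lia.
rewrite r'_sym (_ : z = c d (m - a + a)).
  by apply: connect_arc => j hj; apply: equator_keep; rewrite /m in hj *; lia.
by rewrite subnK ?c_period // /m; lia.
Qed.

End LastPhase.

(** * The root-choice rule and the invariant of the phases *)

Hypothesis T_big : 2 * d <= #|T|.

(** The [pick] keeps the rule valid on components that miss [N], [S] and [z]; its default is reached
    only for the empty set. *)
Definition sphere_rule (C : {set T}) (_ : rel T) : T :=
  if N \in C then N else if S \in C then S else
  if z \in C then z else odflt z [pick x in C].

Lemma sphere_rule_valid : valid_rule sphere_rule.
Proof.
move=> C g /set0Pn [x xC]; rewrite /sphere_rule.
do 3![case: ifP => // _].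
by case: pickP => // /(_ x); rewrite xC.
Qed.

Record state (r : rel T) : Prop := State {
  st_sym : symmetric r;
  st_sub : subrel r e;
  st_eq : equator d r c;
  st_north : intact d r c \/ cut_off d r u row;
  st_south : intact d r (flip d c) \/ cut_off d r u (flip_row d row) }.

Lemma pol_flip : polar e d (flip_row d row) (flip d c).
Proof. exact: polar_flip. Qed.

Lemma flip_equator r : equator d r c -> equator d r (flip d c).
Proof. by move=> eqr j; rewrite /flip mul2n -addnn addnK. Qed.

Lemma flip_u : flip d c d a = u.
Proof. by rewrite /flip mul2n -addnn addnK. Qed.

Lemma flip_pole : flip d c 0 0 = S.
Proof. by rewrite /flip subn0. Qed.

(** Thus a rule that sees only the component can tell which alternative of [st_north] holds. *)
Lemma north_in r : state r -> (N \in Defs.comp r u) <-> intact d r c.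
Proof.
case=> rs re eqr h _; rewrite inE; split => [uN|int].
  by case: h => // /(cut_off_pole d_gt0 pol rs re); rewrite uN.
exact: (connect_column d_gt0 a pol rs).
Qed.

Lemma south_in r : state r -> (S \in Defs.comp r u) <-> intact d r (flip d c).
Proof.
case=> rs re eqr _ h; rewrite inE -flip_pole; split => [uS|int].
  case: h => // h; have := @cut_off_pole _ _ _ d_gt0 _ _ _ a pol_flip rs re.
  by rewrite flip_u => /(_ h); rewrite uS.
by rewrite -flip_u; apply: (connect_column d_gt0 a pol_flip rs).
Qed.

Section SpherePhase.
Variables (R : nat) (ks : {set T} -> 'I_R).
Hypothesis R_big : 2 * d < R.

Lemma cut_off_mono r rw : cut_off d r u rw ->
  cut_off d (kpr_phase R sphere_rule ks r) u rw.
Proof.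
case=> k kd h; exists k => // x y /phase_connect ux xk yk.
by apply/negP => /phase_sub; rewrite h.
Qed.

(** The hypothesis [some] provides a pole to root at; the last conclusion supplies that hypothesis
    again for the second phase. *)
Lemma state_phase r (r' := kpr_phase R sphere_rule ks r) : state r ->
  intact d r c \/ intact d r (flip d c) ->
  state r' /\
  (intact d r c -> intact d r (flip d c) -> intact d r' c \/ intact d r' (flip d c)).
Proof.
move=> st some; have [rs re eqr hN hS] := st.
have r's : symmetric r' by apply: phase_sym.
have r'e : subrel r' e by move=> x y /phase_sub /re.
case: (boolP (N \in Defs.comp r u)) => [NC|NC].
  have int := (north_in st).1 NC.
  have rt : sphere_rule (Defs.comp r u) (restrict r (Defs.comp r u)) = c 0 0.
    by rewrite /sphere_rule NC.
  have eq' := pole_equator d_gt0 pol rs re eqr int ks T_big R_big rt.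
  have near := pole_near d_gt0 pol rs re int ks T_big R_big rt.
  have far := pole_far d_gt0 pol rs re int ks T_big R_big rt.
  split; first split => //.
  - by move: near; case: ifP; [left|right].
  - case: hS => [hS|]; last by right; apply: cut_off_mono.
    by move: (far hS); case: ifP; [right|left].
  - move=> _ /far; move: near; case: ifP => [_|_ _]; first by left.
    by move=> ?; right.
(* Without [N] in the component the south must be whole, and the argument is repeated in flipped
   coordinates. *)
have nint : ~ intact d r c by move/(north_in st); apply/negP.
have SC : S \in Defs.comp r u by apply/(south_in st); case: some.
have int := (south_in st).1 SC.
have rt : sphere_rule (Defs.comp r (flip d c d a))
   (restrict r (Defs.comp r (flip d c d a))) = flip d c 0 0.
  by rewrite flip_u /sphere_rule (negPf NC) SC flip_pole.
have eq' := pole_equator d_gt0 pol_flip rs re (flip_equator eqr) int ks T_big R_big rt.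
have near := pole_near d_gt0 pol_flip rs re int ks T_big R_big rt.
split; first split => //.
- by move=> j; have := eq' j; rewrite /flip mul2n -addnn addnK.
- by case: hN => // hN; right; apply: cut_off_mono.
- by move: near; rewrite flip_u; case: ifP; [left|right].
- by move/nint.
Qed.

Lemma state_last r : state r -> connect (kpr_phase R sphere_rule ks r) u v.
Proof.
move=> st; have [rs re eqr hN hS] := st.
case: (boolP (N \in Defs.comp r u)) => [NC|NC].
  have [st' _] := state_phase st (or_introl ((north_in st).1 NC)).
  exact: connect_equator a (st_sym st') (st_eq st') _.
case: (boolP (S \in Defs.comp r u)) => [SC|SC].
  have [st' _] := state_phase st (or_intror ((south_in st).1 SC)).
  exact: connect_equator a (st_sym st') (st_eq st') _.
apply: last_phase => //.
- by case: hN => // /(north_in st); rewrite (negPf NC).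
- by case: hS => // /(south_in st); rewrite (negPf SC).
rewrite /sphere_rule (negPf NC) (negPf SC) inE ifT //.
exact: connect_equator.
Qed.

End SpherePhase.

Lemma sphere_kpr R (ks1 ks2 ks3 : {set T} -> 'I_R) : 2 * d < R ->
  connect (kpr R sphere_rule ks1 ks2 ks3 e) u v.
Proof.
move=> R_big.
have intN : intact d e c by move=> i j hi; apply: e_column; lia.
have intS : intact d e (flip d c).
  move=> i j hi; rewrite e_sym /flip (_ : 2 * d - i = (2 * d - i.+1).+1); last by lia.
  by apply: e_column; lia.
have st0 : state e by split => //; left.
have [st1 /(_ intN intS) some1] := state_phase ks1 R_big st0 (or_introl intN).
have [st2 _] := state_phase ks2 R_big st1 some1.
exact: state_last.
Qed.

End Sphere.

(** * Planarity from cyclic neighbour lists *)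

(** Labels are constant on orbits and each fibre is a single orbit, so the orbits, represented by
    their roots, are in bijection with the labels. *)
Lemma fcard_label (D : finType) (f : D -> D) (L : eqType) (lab : D -> L)
    (faces : seq L) :
  injective f -> uniq faces -> (forall x, lab x \in faces) ->
  (forall x, lab (f x) = lab x) ->
  (forall l, l \in faces ->
     exists2 x0, lab x0 = l & forall x, lab x = l -> fconnect f x0 x) ->
  fcard f predT = size faces.
Proof.
move=> f_inj f_uniq lab_in lab_f face.
have fsym := fconnect_sym f_inj.
have lab_iter x y : fconnect f x y -> lab y = lab x.
  by move/iter_findex <-; elim: (findex _ _ _) => //= k IH; rewrite lab_f.
have same_lab x y : lab x = lab y -> fconnect f x y.
  move=> h; have [x0 _ h0] := face _ (lab_in y).
  by apply: connect_trans (h0 y erefl); rewrite fsym; apply: h0.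
rewrite /n_comp_mem cardE; set s := enum _.
have s_root x : x \in s = (froot f x == x) by rewrite mem_enum !inE andbT.
rewrite -(size_map lab); apply: perm_size; apply: uniq_perm => //.
  rewrite map_inj_in_uniq ?enum_uniq // => x y.
  rewrite !s_root => /eqP xr /eqP yr /same_lab xy.
  by rewrite -xr -yr; apply/eqP; rewrite root_connect.
move=> l; apply/mapP/idP => [[x _ ->]|/face [x0 <- _]]; first exact: lab_in.
exists (froot f x0); first by rewrite s_root root_root.
exact/esym/lab_iter/connect_root.
Qed.

Section NeighbourLists.
Variables (V : finType) (e : rel V) (nb : V -> seq V).
Hypothesis e_nb : forall x y, e x y = (y \in nb x).
Hypothesis e_sym : symmetric e.
Hypothesis nb_uniq : forall x, uniq (nb x).

Let dart := {p : V * V | e p.1 p.2 && e p.2 p.1}.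

Lemma rot_proof (p : dart) :
  let q := ((val p).1, next (nb (val p).1) (val p).2) in e q.1 q.2 && e q.2 q.1.
Proof.
by case: p => [[x y]] /= /andP [xy _]; rewrite (e_sym _ x) andbb e_nb mem_next -e_nb.
Qed.

Definition rot (p : dart) : dart :=
  exist _ ((val p).1, next (nb (val p).1) (val p).2) (rot_proof p).

(** The face permutation, [rot] of the reversed dart, on bare pairs without membership proofs. *)
Definition face_step (p : V * V) := (p.2, next (nb p.2) p.1).

Lemma dart_nb (p : dart) : (val p).2 \in nb (val p).1.
Proof. by case: p => [[x y]] /= /andP [xy _]; rewrite -e_nb. Qed.

Lemma rot_system : rotation_system rot.
Proof.
split; last split => //.
- move=> [[x y] p] [[x' y'] q] /(congr1 val) /= [xx' ny].
  apply: val_inj; move: ny; rewrite /= -xx'.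
  by move/(can_inj (prev_next (nb_uniq x))) ->.
- move=> p q pq; have hp := dart_nb p; have := dart_nb q; rewrite -pq => hq.
  set x := (val p).1 in pq hp hq.
  have := fconnect_cycle (cycle_next (nb_uniq x)) hp (val q).2; rewrite hq.
  move/iter_findex; set k := findex _ _ _ => h; exists k.
  apply: val_inj; rewrite [RHS]surjective_pairing -pq -h.
  by elim: (k) => [|j /= ->] //=; apply: surjective_pairing.
Qed.

Lemma card_darts : #|{: dart}| = \sum_x size (nb x).
Proof.
rewrite card_sig -sum1_card.
rewrite (eq_bigl (fun p => (true && (p.2 \in nb p.1)))); last first.
  by move=> [x y]; rewrite !inE /= (e_sym y x) andbb e_nb.
rewrite -(pair_big_dep xpredT (fun x y => y \in nb x) (fun _ _ => 1)) /=.
by apply: eq_bigr => x _; rewrite sum1_card; apply/card_uniqP.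
Qed.

(** Planarity becomes a computation: faces are counted by labels, and a traversal from one chosen
    dart shows that each label is a single orbit. *)
Lemma planar_nb (L : eqType) (lab : V -> V -> L) (faces : seq L) :
  uniq faces ->
  (forall x y, y \in nb x -> lab x y \in faces) ->
  (forall x y, y \in nb x -> lab y (next (nb y) x) = lab x y) ->
  (forall l, l \in faces -> exists x0 y0, [/\ y0 \in nb x0, lab x0 y0 = l &
     forall x y, y \in nb x -> lab x y = l ->
       exists k, iter k face_step (x0, y0) = (x, y)]) ->
  #|V| + size faces = (\sum_x size (nb x))./2 + 2 ->
  planar_connected e.
Proof.
move=> f_uniq lab_in lab_step face euler; right; exists rot.
split; first exact: rot_system.
rewrite card_darts -euler; congr addn.
apply: (@fcard_label _ _ _ (fun p : dart => lab (val p).1 (val p).2)) => //.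
- move=> [[x y] p] [[x' y'] q] /(rot_system.1) /(congr1 val) /= [h1 h2].
  by apply: val_inj; rewrite /= h1 h2.
- by move=> p; apply/lab_in/dart_nb.
- by move=> p; rewrite /= lab_step // dart_nb.
- move=> l /face [x0 [y0 [h0 hl h]]].
  have d0 : e x0 y0 && e y0 x0 by rewrite e_sym andbb e_sym e_nb.
  exists (exist _ (x0, y0) d0) => // p /(h _ _ (dart_nb p)) [k hk].
  suff -> : p = iter k (fun d => rot (drev d)) (exist _ (x0, y0) d0) by apply: fconnect_iter.
  apply: val_inj; move: hk; rewrite -surjective_pairing => <-.
  by elim: k => //= k ->.
Qed.

End NeighbourLists.

(** * The grid on the sphere *)

Lemma next_mkseq (T : eqType) (F : nat -> T) q k : uniq (mkseq F q) -> k < q ->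
  next (mkseq F q) (F k) = if k.+1 == q then F 0 else F k.+1.
Proof.
move=> F_uniq kq; have kE : F k = nth (F 0) (mkseq F q) k by rewrite nth_mkseq.
have kin : F k \in mkseq F q by rewrite kE mem_nth // size_mkseq.
have ik : index (F k) (mkseq F q) = k by rewrite kE index_uniq ?size_mkseq.
rewrite next_nth kin ik; case: q kq {F_uniq kE kin ik} => // q kq.
rewrite /mkseq /=; case: eqP => [[->]|kq'].
  by rewrite nth_default // size_map size_iota.
by rewrite (nth_map 0) ?size_iota ?nth_iota //; lia.
Qed.

Lemma next4 (T : eqType) (a b c d : T) : uniq [:: a; b; c; d] ->
  [/\ next [:: a; b; c; d] a = b, next [:: a; b; c; d] b = c,
      next [:: a; b; c; d] c = d & next [:: a; b; c; d] d = a].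
Proof.
rewrite /= !inE !negb_or => /and4P [/and3P [ab ac ad] /andP [bc bd] cd _].
by rewrite !eqxx ![b == _]eq_sym ![c == _]eq_sym ![d == _]eq_sym
  (negPf ab) (negPf ac) (negPf ad) (negPf bc) (negPf bd) (negPf cd).
Qed.

Section Globe.
Variables d t n H m A : nat.
Hypothesis d_gt0 : 0 < d.
Hypothesis H_def : H = 2 * d.
Hypothesis m_def : m = H.+1.
Hypothesis A_def : A = H.-1 * m.
Hypothesis n_def : n = A + 2 + t.

Lemma m_gt0 : 0 < m. Proof. by rewrite m_def. Qed.

Lemma modS j : j.+1 %% m = if (j %% m).+1 == m then 0 else (j %% m).+1.
Proof.
have jm := ltn_pmod j m_gt0.
rewrite -addn1 -modnDml addn1; case: eqP => [->|h]; first by rewrite modnn.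
by rewrite modn_small //; lia.
Qed.

(** Adding [m.-1] is the step one column west, free of truncated subtraction. *)
Lemma mod_pred j : (j.+1 + m.-1) %% m = j %% m.
Proof. by rewrite addSn -addnS prednK ?m_gt0 // modnDr. Qed.

(* [A] vertices lie strictly between the poles.  Coordinates are (row, column);
   row 0 consists of the north pole (0, 0) and of the [t] extra leaves (0, 1),
   ..., (0, t), and row [H] of the south pole. *)
Definition coord k :=
  if k < A then ((k %/ m).+1, k %% m) else if k == A then (H, 0) else (0, k - A.+1).

Definition index_of i j := if i == 0 then A.+1 + j else if i == H then A else i.-1 * m + j.

Definition good i j :=
  if i == 0 then j <= t else if i == H then j == 0 else (i < H) && (j < m).

Lemma index_lt i j : 0 < i < H -> j < m -> i.-1 * m + j < A.
Proof.
move=> hi hj; rewrite A_def; apply: (@leq_trans (i.-1.+1 * m)).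
  by rewrite mulSn addnC ltn_add2r.
by rewrite leq_mul2r; apply/orP; right; lia.
Qed.

Lemma index_bound i j : good i j -> index_of i j < n.
Proof.
rewrite /good /index_of n_def; case: eqP => [_|i0]; first by lia.
case: eqP => [_|iH]; first by lia.
by move=> /andP [iH' jm]; have := @index_lt i j _ jm; lia.
Qed.

Lemma index_ofK i j : good i j -> coord (index_of i j) = (i, j).
Proof.
rewrite /good /index_of /coord; case: eqP => [-> _|i0].
  by rewrite !ifF; [congr pair; lia|lia|lia].
case: eqP => [-> /eqP ->|iH /andP [iH' jm]]; first by rewrite ltnn eqxx.
have hi : 0 < i < H by lia.
rewrite index_lt // divnMDl ?m_gt0 // modnMDl modn_small // divn_small //.
by congr pair; lia.
Qed.

Lemma coord_good k : k < n -> good (coord k).1 (coord k).2.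
Proof.
rewrite /coord /good n_def => kn; case: ltnP => [kA|kA] /=.
  have := kA; rewrite A_def -ltn_divLR ?m_gt0 // => hk.
  have := ltn_pmod k m_gt0; move=> hm.
  by move: (k %/ m) (k %% m) hk hm => p q; case: eqP; lia.
case: (eqVneq k A) => [_|kA'] /=; last by lia.
by rewrite eqxx ifF //; lia.
Qed.

Lemma coordK k : k < n -> index_of (coord k).1 (coord k).2 = k.
Proof.
rewrite /coord /index_of n_def => kn; case: ltnP => [kA|kA] /=.
  have := kA; rewrite A_def -ltn_divLR ?m_gt0 // => hk.
  by rewrite ifF; [rewrite -divn_eq|lia].
case: (eqVneq k A) => [->|kA'] /=; last by lia.
by rewrite eqxx ifF //; lia.
Qed.

Lemma n_gt0 : 0 < n. Proof. by rewrite n_def; lia. Qed.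

Let V := 'I_n.

(** The default of [insubd] is never reached on [good] coordinates, by [index_bound]. *)
Definition vtx i j : V := insubd (Ordinal n_gt0) (index_of i j).
Definition row (x : V) := (coord x).1.
Definition column (x : V) := (coord x).2.

Lemma coord_vtx i j : good i j -> coord (vtx i j) = (i, j).
Proof. by move=> g; rewrite /vtx val_insubd index_bound // index_ofK. Qed.

Lemma vtxK x : vtx (row x) (column x) = x.
Proof. by apply: val_inj; rewrite val_insubd coordK ?ltn_ord. Qed.

Definition grid i j := if i == 0 then vtx 0 0 else if i == H then vtx H 0 else vtx i (j %% m).
Let N := grid 0 0.
Definition leaf k := vtx 0 k.

Lemma good_grid i j : i <= H ->
  good i (if (i == 0) || (i == H) then 0 else j %% m).
Proof.
have := ltn_pmod j m_gt0; rewrite /good => jm iH.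
case: (eqVneq i 0) => //= i0; case: (eqVneq i H) => //= iH'; lia.
Qed.

Lemma coord_grid i j : i <= H ->
  coord (grid i j) = (i, if (i == 0) || (i == H) then 0 else j %% m).
Proof.
move=> iH; rewrite -coord_vtx ?good_grid //; congr (coord (val _)); rewrite /grid.
by case: eqP => [->|_] //=; case: eqP => [->|].
Qed.

Lemma row_grid i j : i <= H -> row (grid i j) = i.
Proof. by move=> iH; rewrite /row coord_grid. Qed.

Lemma column_grid i j : 0 < i < H -> column (grid i j) = j %% m.
Proof. by move=> iH; rewrite /column coord_grid ?ifF //; lia. Qed.

Lemma coord_leaf k : k <= t -> coord (leaf k) = (0, k).
Proof. by move=> kt; rewrite coord_vtx. Qed.

Lemma grid_mod i j j' : j = j' %[mod m] -> grid i j = grid i j'.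
Proof. by rewrite /grid => ->. Qed.

Lemma grid_pred i j : grid i (j.+1 + m.-1) = grid i j.
Proof. by apply/grid_mod/mod_pred. Qed.

Lemma grid0 j : grid 0 j = N. Proof. by []. Qed.

Lemma gridH j : grid H j = grid H 0.
Proof. by rewrite /grid eqxx. Qed.

Variant vertex_spec : V -> Prop :=
| VertexGrid i j of i <= H : vertex_spec (grid i j)
| VertexLeaf k of k < t : vertex_spec (leaf k.+1).

Lemma vertexP x : vertex_spec x.
Proof.
rewrite -(vtxK x); have := coord_good (ltn_ord x); rewrite -/(row x) -/(column x).
move: (row x) (column x) => i j; rewrite /good.
case: (eqVneq i 0) => [->|i0].
  by case: j => [|k] kt; [exact: (@VertexGrid 0 0)|exact: VertexLeaf].
case: (eqVneq i H) => [->|iH].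
  by move/eqP->; have := @VertexGrid H 0 (leqnn _); rewrite /grid eqxx ifF //; lia.
case/andP => iH' jm; have := @VertexGrid i j (ltnW iH').
by rewrite /grid modn_small // (negPf i0) (negPf iH).
Qed.

(** * Cyclic neighbour lists of the sphere *)

Definition nb_north k := if k < t then leaf k.+1 else grid 1 (m.-1 - (k - t)).

(** Lists run clockwise as seen from outside: north, east, south, west on a ring, hence decreasing
    columns at the north pole and increasing ones at the south pole. The leaves fill the gap from
    column 0 to column [m - 1]. *)
Definition nb (x : V) : seq V :=
  let: (i, j) := coord x in
  if i == 0 then if j == 0 then mkseq nb_north (t + m) else [:: N]
  else if i == H then mkseq (grid H.-1) m
  else [:: grid i.-1 j; grid i j.+1; grid i.+1 j; grid i (j + m.-1)].

Lemma nb_N : nb N = mkseq nb_north (t + m).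
Proof. by rewrite /nb coord_grid. Qed.

Lemma nb_leaf k : k < t -> nb (leaf k.+1) = [:: N].
Proof. by move=> kt; rewrite /nb coord_leaf. Qed.

Lemma nb_south : nb (grid H 0) = mkseq (grid H.-1) m.
Proof. by rewrite /nb coord_grid // eqxx orbT ifF //; lia. Qed.

Lemma nb_grid i j : 0 < i < H ->
  nb (grid i j) = [:: grid i.-1 j; grid i j.+1; grid i.+1 j; grid i (j + m.-1)].
Proof.
move=> hi; rewrite /nb coord_grid; last by lia.
have [-> ->] : (i == 0) = false /\ (i == H) = false by lia.
have E k l : grid k (j %% m + l) = grid k (j + l) by apply: grid_mod; rewrite modnDml.
by rewrite /= -addn1 !E addn1 -[j %% m]addn0 !E addn0.
Qed.

Lemma grid1_inj j j' : j < m -> j' < m -> grid 1 j = grid 1 j' -> j = j'.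
Proof.
move=> hj hj' /(congr1 column); rewrite !column_grid ?modn_small //; lia.
Qed.

Lemma nb_uniq x : uniq (nb x).
Proof.
case: x / (vertexP x) => [i j iH|k kt]; last by rewrite nb_leaf.
case: (eqVneq i 0) => [->|i0].
  rewrite grid0 nb_N; apply/mkseq_uniqP => k k'; rewrite !inE /nb_north => hk hk'.
  have rn q : row (if q < t then leaf q.+1 else grid 1 (m.-1 - (q - t))) = (t <= q).
    by rewrite /row; case: ltnP => h; rewrite ?coord_leaf ?coord_grid //; lia.
  move=> E; have := congr1 row E; rewrite !rn => rE.
  move: E; case: ltnP => h; case: ltnP => h'; [|lia|lia|].
    by move/(congr1 column); rewrite /column !coord_leaf // => -[].
  by move/grid1_inj => /(_ _ _); lia.
case: (eqVneq i H) => [->|iH'].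
  rewrite gridH nb_south; apply/mkseq_uniqP => k k'; rewrite !inE => hk hk'.
  by move/(congr1 column); rewrite !column_grid ?modn_small //; lia.
have hi : 0 < i < H by lia.
rewrite nb_grid //=.
have rneq p q p' q' : p <= H -> p' <= H -> p <> p' -> (grid p q == grid p' q') = false.
  by move=> hp hp' pp'; apply/eqP => /(congr1 row); rewrite !row_grid.
have E1 q q' : (grid i.-1 q == grid i q') = false by apply: rneq; lia.
have E2 q q' : (grid i.-1 q == grid i.+1 q') = false by apply: rneq; lia.
have E3 q q' : (grid i q == grid i.+1 q') = false by apply: rneq; lia.
have E4 q q' : (grid i.+1 q == grid i q') = false by apply: rneq; lia.
rewrite !inE !negb_or !E1 E2 E3 E4 /= andbT.
(* The eastern and western neighbours differ because [m >= 3]. *)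
apply/eqP => /(congr1 column); rewrite !column_grid // => /eqP.
rewrite -addn1 eqn_modDl !modn_small //; lia.
Qed.

Definition globe : rel V := fun x y => y \in nb x.

(* Columns range over all of [nat], with [grid i j] periodic in [j]; shifting some
   of them by one avoids predecessors modulo [m]. *)
Variant dart : V -> V -> Prop :=
| Down i j of i < H : dart (grid i j) (grid i.+1 j)
| Up i j of i < H : dart (grid i.+1 j.+1) (grid i j.+1)
| East i j of 0 < i < H : dart (grid i j) (grid i j.+1)
| West i j of 0 < i < H : dart (grid i j.+1) (grid i j)
| Out k of k < t : dart N (leaf k.+1)
| In k of k < t : dart (leaf k.+1) N.

Lemma up_dart i j : i < H -> dart (grid i.+1 j) (grid i j).
Proof. by move=> iH; rewrite -(grid_pred _ j) -(grid_pred i j) addSn; apply: Up. Qed.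

Lemma dartP x y : reflect (dart x y) (y \in nb x).
Proof.
apply: (iffP idP) => [|[i j iH|i j iH|i j iH|i j iH|k kt|k kt]].
- case: x / (vertexP x) => [i j iH|k kt]; last by rewrite nb_leaf // inE => /eqP ->; apply: In.
  case: (eqVneq i 0) => [->|i0].
    rewrite grid0 nb_N => /mapP [k]; rewrite mem_iota add0n => kt ->; rewrite /nb_north.
    case: ltnP => h; first exact: Out.
    by rewrite -(grid0 (m.-1 - (k - t))); apply: Down; lia.
  case: (eqVneq i H) => [->|iH'].
    rewrite gridH nb_south => /mapP [k]; rewrite mem_iota add0n => kt ->.
    rewrite -(gridH k); have -> : H = H.-1.+1 by lia.
    by apply: up_dart; lia.
  rewrite nb_grid; last by lia.
  rewrite !inE => /or4P [] /eqP ->.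
  + by have := @up_dart i.-1 j; rewrite prednK; [apply; lia|lia].
  + by apply: East; lia.
  + by apply: Down; lia.
  + rewrite -{1}(grid_pred i j) addSn; apply: West; lia.
- case: (posnP i) => [->|i0].
    (* The list at [N] has the [t] leaves first and then the columns in decreasing order. *)
    rewrite grid0 nb_N; apply/mapP; exists (t + (m.-1 - j %% m)).
      by rewrite mem_iota; have := ltn_pmod j m_gt0; lia.
    have := ltn_pmod j m_gt0 => jm.
    rewrite /nb_north ifF; last by lia.
    by apply: grid_mod; rewrite -[LHS]modn_mod; congr modn; lia.
  by rewrite nb_grid; [rewrite !inE eqxx !orbT|lia].
- case: (ltnP i.+1 H) => h; first by rewrite nb_grid //= inE eqxx.
  have -> : i.+1 = H by lia. 
  rewrite gridH nb_south; apply/mapP; exists (j.+1 %% m); first by rewrite mem_iota ltn_pmod ?m_gt0.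
  have -> : i = H.-1 by lia.
  by apply: grid_mod; rewrite modn_mod.
- by rewrite nb_grid // !inE eqxx !orbT.
- by rewrite nb_grid // !inE grid_pred eqxx !orbT.
- rewrite nb_N; apply/mapP; exists k; first by rewrite mem_iota; lia.
  by rewrite /nb_north kt.
- by rewrite nb_leaf // inE.
Qed.

Lemma globe_sym : symmetric globe.
Proof.
suff imp x y : globe x y -> globe y x by move=> x y; apply/idP/idP; apply: imp.
rewrite /globe => /dartP [i j iH|i j iH|i j iH|i j iH|k kt|k kt]; apply/dartP.
- exact: up_dart.
- exact: Down.
- exact: West.
- exact: East.
- exact: In.
- exact: Out.
Qed.

(* The face on the left of the dart (x, y), seen with north up: (i, j) is the
   face between rows i, i + 1 and columns j, j + 1.  Poles carry no column of
   their own, and the leaves sit in the face (0, m - 1). *)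
Definition face_of (x y : V) : nat * nat :=
  if row y == (row x).+1 then (row x, column (if row x == 0 then y else x))
  else if row x == (row y).+1 then
    (row y, (column (if row x == H then y else x) + m.-1) %% m)
  else if row x == 0 then (0, m.-1)
  else if column y == (column x).+1 %% m then ((row x).-1, column x)
  else (row x, column y).

Lemma face_down i j : i < H -> face_of (grid i j) (grid i.+1 j) = (i, j %% m).
Proof.
move=> iH; rewrite /face_of !row_grid ?eqxx; [congr pair|lia|lia].
by case: (eqVneq i 0) => [->|h]; rewrite column_grid //; lia.
Qed.

Lemma face_up i j : i < H -> face_of (grid i.+1 j.+1) (grid i j.+1) = (i, j %% m).
Proof.
move=> iH; rewrite /face_of !row_grid ?eqxx; [|lia..].
have -> : (i == i.+2) = false by lia.
congr pair; rewrite -[RHS]mod_pred -[RHS]modnDml; congr modn; congr addn.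
by case: (eqVneq i.+1 H) => h; rewrite column_grid //; lia.
Qed.

Lemma face_east i j : 0 < i < H -> face_of (grid i j) (grid i j.+1) = (i.-1, j %% m).
Proof.
move=> hi; rewrite /face_of !row_grid ?column_grid //; try lia.
have [-> ->] : (i == i.+1) = false /\ (i == 0) = false by lia.
by rewrite -[(j %% m).+1]addn1 modnDml addn1 eqxx.
Qed.

(** The dart is not mistaken for an eastward one, as [j] and [j + 2] differ modulo [m >= 3]. *)
Lemma face_west i j : 0 < i < H -> face_of (grid i j.+1) (grid i j) = (i, j %% m).
Proof.
move=> hi; rewrite /face_of !row_grid ?column_grid //; try lia.
have [-> ->] : (i == i.+1) = false /\ (i == 0) = false by lia.
rewrite ifF // -[(j.+1 %% m).+1]addn1 modnDml addn1 -addn2 -{1}[j]addn0.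
rewrite eqn_modDl !modn_small //; lia.
Qed.

Lemma face_out k : k < t -> face_of N (leaf k.+1) = (0, m.-1).
Proof. by move=> kt; rewrite /face_of /row coord_leaf // coord_grid. Qed.

Lemma face_in k : k < t -> face_of (leaf k.+1) N = (0, m.-1).
Proof. by move=> kt; rewrite /face_of /row coord_leaf // coord_grid. Qed.

(** * Boundary walks of the faces *)

Lemma next_grid i j : 0 < i < H ->
  [/\ next (nb (grid i j.+1)) (grid i.-1 j.+1) = grid i j.+2,
      next (nb (grid i j.+1)) (grid i j.+2) = grid i.+1 j.+1,
      next (nb (grid i j.+1)) (grid i.+1 j.+1) = grid i j &
      next (nb (grid i j.+1)) (grid i j) = grid i.-1 j.+1].
Proof.
move=> hi; have := nb_uniq (grid i j.+1).
by rewrite nb_grid // grid_pred => /next4.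
Qed.

Lemma next_down i j : 0 < i < H -> next (nb (grid i j)) (grid i.-1 j) = grid i j.+1.
Proof.
move=> hi; have [+ _ _ _] := next_grid (j + m.-1) hi.
by rewrite -!addSn !grid_pred.
Qed.

Lemma next_south j : next (nb (grid H 0)) (grid H.-1 j) = grid H.-1 j.+1.
Proof.
have jm := ltn_pmod j m_gt0.
have := nb_uniq (grid H 0); rewrite nb_south => U.
rewrite (@grid_mod _ j (j %% m)) ?modn_mod // next_mkseq //.
by rewrite (@grid_mod _ j.+1 (j.+1 %% m)) ?modn_mod // modS; case: ifP.
Qed.

Lemma next_north j : (0 < j) && (j < m) -> next (nb N) (grid 1 j) = grid 1 j.-1.
Proof.
move=> hj; have := nb_uniq N; rewrite nb_N => U.
have E i : i < m -> grid 1 i = nb_north (t + (m.-1 - i)).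
  by move=> im; rewrite /nb_north ifF; [congr grid; lia|lia].
rewrite (E j) ?next_mkseq ?E //; try lia.
by rewrite ifF; [congr nb_north; lia|lia].
Qed.

(** The list wraps around here: after column 0 comes the first leaf, or column [m - 1] if
    [t = 0]. *)
Lemma next_north0 : next (nb N) (grid 1 0) = nb_north 0.
Proof.
have := nb_uniq N; rewrite nb_N => U.
have -> : grid 1 0 = nb_north (t + m.-1) by rewrite /nb_north ifF; [congr grid; lia|lia].
by rewrite next_mkseq // ?ifT //; lia.
Qed.

Lemma next_north_leaf k : k < t -> next (nb N) (leaf k.+1) = nb_north k.+1.
Proof.
move=> kt; have := nb_uniq N; rewrite nb_N => U.
have -> : leaf k.+1 = nb_north k by rewrite /nb_north kt.
by rewrite next_mkseq // ?ifF //; lia.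
Qed.

Lemma next_leaf k : k < t -> next (nb (leaf k.+1)) N = N.
Proof. by move=> kt; rewrite nb_leaf //= eqxx. Qed.

Lemma face_north k : k <= t -> face_of N (nb_north k) = (0, m.-1).
Proof.
rewrite leq_eqVlt /nb_north => /orP [/eqP ->|kt]; last by rewrite kt face_out.
rewrite ltnn -(grid0 (m.-1 - (t - t))) face_down; last by lia.
by rewrite subnn subn0 modn_small //; lia.
Qed.

(** The neighbour of [y] clockwise after [x] is the sharpest left turn, so the face on the left
    stays the same. *)
Lemma face_of_step x y : dart x y -> face_of y (next (nb y) x) = face_of x y.
Proof.
case=> [i j iH|i j iH|i j hi|i j hi|k kt|k kt].
- rewrite face_down //; case: (ltnP i.+1 H) => h.
    by rewrite (@next_down i.+1) // face_east.
  have -> : i.+1 = H by lia.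
  have -> : i = H.-1 by lia.
  by rewrite gridH next_south -(gridH j.+1) -{1}(@prednK H) ?face_up //; lia.
- rewrite face_up //; case: (posnP i) => [->|i0].
    rewrite grid0; case: (posnP (j.+1 %% m)) => h.
      rewrite (@grid_mod _ j.+1 0) ?h ?mod0n // next_north0 face_north //.
      by move: h; rewrite modS; case: eqP => // h _; congr pair; lia.
    have jm := ltn_pmod j.+1 m_gt0.
    rewrite (@grid_mod _ j.+1 (j.+1 %% m)) ?modn_mod // next_north ?h //.
    rewrite -(grid0 (j.+1 %% m).-1) face_down //; last by lia.
    by congr pair; move: h; rewrite modS; case: eqP => //= _ _; rewrite modn_mod.
  have hi : 0 < i < H by lia.
  by have [_ _ -> _] := next_grid j hi; rewrite face_west.
- by have [_ _ _ ->] := next_grid j hi; rewrite face_east // -{1}(@prednK i) ?face_up //; lia.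
- have [_ + _ _] := next_grid (j + m.-1) hi.
  rewrite -!addSn !grid_pred => ->; rewrite face_west // face_down //; lia.
- by rewrite next_leaf // face_in // face_out.
- by rewrite next_north_leaf // face_in // face_north.
Qed.

Definition reach p q := exists k, iter k (face_step nb) p = q.

Lemma reach_refl p : reach p p. Proof. by exists 0. Qed.

Lemma reach_step p x y z : reach p (x, y) -> next (nb y) x = z -> reach p (y, z).
Proof. by case=> k hk <-; exists k.+1; rewrite iterS hk. Qed.

(** Each face is followed from its western side: down, east, up, west, without the east dart next to
    the south pole and without the west dart next to the north pole. *)
Lemma reach_face x y : dart x y ->
  reach (grid (face_of x y).1 (face_of x y).2, grid (face_of x y).1.+1 (face_of x y).2) (x, y).
Proof.
have mE i j : grid i (j %% m) = grid i j by apply: grid_mod; rewrite modn_mod.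
have east i j : 0 < i < H -> reach (grid i.-1 j, grid i j) (grid i j, grid i j.+1).
  by move=> hi; apply: reach_step (reach_refl _) (next_down _ _).
have up i j : i < H -> reach (grid i j, grid i.+1 j) (grid i.+1 j.+1, grid i j.+1).
  move=> iH; case: (ltnP i.+1 H) => h.
    have hi : 0 < i.+1 < H by lia.
    by have [_ _ _ /(reach_step (east _ _ hi))] := next_grid j hi.
  have -> : i.+1 = H by lia.
  have -> : i = H.-1 by lia.
  rewrite !(gridH j.+1) (gridH j).
  by apply: reach_step (reach_refl _) (next_south _).
(* The walk around face [(0, m - 1)] comes back to [N] along column 0 and then visits the leaves one
   after another. *)
have in_out k : k < t -> reach (N, grid 1 m.-1) (N, leaf k.+1).
  elim: k => [|k IH] kt.
    have /up : 0 < H by lia.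
    move/(_ m.-1); rewrite !grid0 (@grid_mod _ m.-1.+1 0); last first.
      by rewrite prednK ?modnn ?mod0n //; lia.
    by move/reach_step; apply; rewrite next_north0 /nb_north kt.
  apply: reach_step (_ : next (nb N) (leaf k.+1) = _); last first.
    by rewrite next_north_leaf ?/nb_north ?kt //; lia.
  apply: reach_step (next_leaf _); last by lia.
  by apply: IH; lia.
case=> [i j iH|i j iH|i j hi|i j hi|k kt|k kt].
- by rewrite face_down // !mE; apply: reach_refl.
- by rewrite face_up // !mE; apply: up.
- by rewrite face_east //= !mE prednK; [apply: east|lia].
- rewrite face_west // !mE; have iH : i < H by lia.
  by have [_ _ h _] := next_grid j hi; apply: reach_step (up _ _ iH) h.
- by rewrite face_out //; apply: in_out.
- by rewrite face_in //; apply: reach_step (next_leaf kt); apply: in_out.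
Qed.

(** * Degrees, Euler's formula and connectedness *)

Lemma size_nb k (kn : k < n) : size (nb (Ordinal kn)) =
  if k < A then 4 else if k == A then m else if k == A.+1 then t + m else 1.
Proof.
rewrite /nb /= /coord; case: ltnP => kA.
  have := kA; rewrite A_def -ltn_divLR ?m_gt0 // => h.
  by rewrite ifF //; lia.
case: (eqVneq k A) => [_|kA']; first by rewrite ifF ?eqxx ?size_mkseq //; lia.
case: (eqVneq k A.+1) => [->|kA'']; first by rewrite subnn eqxx size_mkseq.
by rewrite ifF //; lia.
Qed.

Lemma sum_size_nb : \sum_x size (nb x) = (A * 2 + m + t).*2.
Proof.
pose s k := if k < A then 4 else if k == A then m else if k == A.+1 then t + m else 1.
rewrite (eq_bigr (fun x : V => s x)); last by move=> [k kn] _; rewrite size_nb.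
(* Indices below [A] are ring vertices, [A] and [A + 1] the south and north poles, the remaining [t]
   the leaves. *)
rewrite -(big_mkord xpredT s) n_def (@big_cat_nat _ _ _ A.+2) /=; [|lia|lia].
rewrite !big_nat_recr //= {2 3}/s ltnn eqxx.
rewrite (_ : \sum_(0 <= i < A) s i = A * 4); last first.
  rewrite (eq_big_nat _ _ (F2 := fun=> 4)) => [|k]; last by rewrite /s => /andP [_ ->].
  by rewrite sum_nat_const_nat subn0.
rewrite (_ : \sum_(A.+2 <= i < A + 2 + t) s i = t); last first.
  rewrite (eq_big_nat _ _ (F2 := fun=> 1)) => [|k hk].
    by rewrite sum_nat_const_nat; lia.
  by rewrite /s !ifF //; lia.
have [-> ->] : (A.+1 < A) = false /\ (A.+1 == A) = false by lia.
by rewrite eqxx; lia.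
Qed.

Lemma globe_planar : planar_connected globe.
Proof.
apply: (@planar_nb _ globe nb _ globe_sym nb_uniq _ face_of
  [seq (i, j) | i <- iota 0 H, j <- iota 0 m]) => //.
- by apply: allpairs_uniq; rewrite ?iota_uniq // => -[i j] [i' j'] _ _ [-> ->].
- move=> x y /dartP xy; apply/allpairsP; exists (face_of x y); rewrite !mem_iota.
  case: xy => [i j iH|i j iH|i j hi|i j hi|k kt|k kt].
  + by rewrite face_down //= ltn_pmod ?m_gt0; split => //; lia.
  + by rewrite face_up //= ltn_pmod ?m_gt0; split => //; lia.
  + by rewrite face_east //= ltn_pmod ?m_gt0; split => //; lia.
  + by rewrite face_west //= ltn_pmod ?m_gt0; split => //; lia.
  + by rewrite face_out //=; split => //; lia.
  + by rewrite face_in //=; split => //; lia.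
- by move=> x y /dartP /face_of_step.
- move=> l /allpairsP [[i j] /=]; rewrite !mem_iota => -[hi hj ->].
  exists (grid i j), (grid i.+1 j); split.
  + by apply/dartP; apply: Down; lia.
  + by rewrite face_down ?modn_small //; lia.
  + by move=> x y /dartP /reach_face + E; rewrite E.
(* Euler's formula holds with [A + 2 + t] vertices, [2 * A + m + t] edges and [H * m = A + m]
   faces. *)
rewrite card_ord size_allpairs !size_iota sum_size_nb doubleK n_def.
have -> : H * m = H.-1 * m + m by rewrite -mulSnr prednK //; lia.
rewrite -A_def; lia.
Qed.

Lemma globe_connected : connected_graph globe.
Proof.
have sym := sym_connect_sym globe_sym.
suff toN x : connect globe N x by move=> x y; apply: connect_trans (toN y); rewrite sym.
case: x / (vertexP x) => [i j|k kt]; last by apply/connect1/dartP; apply: Out.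
elim: i => [|i IH] iH; first by rewrite grid0.
apply: connect_trans (IH (ltnW iH)) (connect1 _).
by apply/dartP; apply: Down.
Qed.

Lemma dart_neq x y : dart x y -> x <> y.
Proof.
case=> [i j iH|i j iH|i j hi|i j hi|k kt|k kt].
- by move/(congr1 row); rewrite !row_grid; lia.
- by move/(congr1 row); rewrite !row_grid; lia.
- by move/(congr1 column); rewrite !column_grid // modS; case: eqP; lia.
- by move/(congr1 column); rewrite !column_grid // modS; case: eqP; lia.
- by move/(congr1 column); rewrite /column coord_leaf // coord_grid.
- by move/(congr1 column); rewrite /column coord_leaf // coord_grid.
Qed.

Lemma globe_simple : simple_graph globe.
Proof.
split=> [|x]; first exact: globe_sym.
by apply/negP => /dartP /dart_neq.
Qed.

(** Leaf numbers may exceed [m], while [col] must always be a ring position; on the rings the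
    reduction changes nothing. *)
Definition col x := column x %% m.

Lemma dart_rows x y : dart x y -> row y <= (row x).+1 /\
  (row y = (row x).+1 -> exists j, x = grid (row x) j /\ y = grid (row y) j).
Proof.
case=> [i j iH|i j iH|i j hi|i j hi|k kt|k kt].
- by rewrite !row_grid; [split=> // _; exists j|lia..].
- by rewrite !row_grid; [lia..].
- by rewrite !row_grid; [lia..].
- by rewrite !row_grid; [lia..].
- by rewrite /row coord_leaf ?coord_grid.
- by rewrite /row coord_leaf ?coord_grid.
Qed.

Lemma globe_polar : polar globe d row grid.
Proof.
split.
- by move=> x y /dartP /dart_rows [].
- by move=> i j; rewrite -H_def => /row_grid.
- by [].
- by move=> x y /dartP /dart_rows [_].
Qed.

Lemma row_le x : row x <= H.
Proof.
by case: x / (vertexP x) => [i j iH|k kt]; rewrite ?row_grid // /row coord_leaf.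
Qed.

Lemma col_lip x y : dart x y -> 0 < row x < H -> 0 < row y < H ->
  ring_dist d (col x) (col y) <= 1.
Proof.
have ns i j : 0 < i < H -> ring_dist d (col (grid i j)) (col (grid i j.+1)) <= 1 /\
    ring_dist d (col (grid i j.+1)) (col (grid i j)) <= 1.
  move=> hi; rewrite /col !column_grid // !modn_mod modS /ring_dist -H_def -m_def.
  by have := ltn_pmod j m_gt0; case: eqP; lia.
case=> [i j iH|i j iH|i j hi|i j hi|k kt|k kt].
- by rewrite !row_grid; [move=> hi hi'; rewrite /col !column_grid // /ring_dist; lia|lia..].
- by rewrite !row_grid; [move=> hi hi'; rewrite /col !column_grid // /ring_dist; lia|lia..].
- by move=> _ _; have [] := ns i j hi.
- by move=> _ _; have [] := ns i j hi.
- by rewrite {1}/row coord_grid.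
- by rewrite {1}/row coord_leaf.
Qed.

Lemma globe_kpr : exists u v : 'I_n, is_dist globe u v d /\
    exists rule : {set 'I_n} -> rel 'I_n -> 'I_n, valid_rule rule /\
      forall R : nat, 2 * d < R ->
      forall ks1 ks2 ks3 : {set 'I_n} -> 'I_R,
        connect (kpr R rule ks1 ks2 ks3 globe) u v.
Proof.
have mE : (2 * d).+1 = m by rewrite -H_def.
have period : grid d (2 * d).+1 = grid d 0 by rewrite mE; apply: grid_mod; rewrite modnn mod0n.
have col_c j : j < (2 * d).+1 -> col (grid d j) = j.
  by rewrite mE => jm; rewrite /col column_grid ?modn_mod ?modn_small //; lia.
have col_lt x : col x < (2 * d).+1 by rewrite mE ltn_pmod ?m_gt0.
have lip x y : globe x y -> 0 < row x < 2 * d -> 0 < row y < 2 * d ->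
    ring_dist d (col x) (col y) <= 1.
  by rewrite -H_def => /dartP /col_lip.
have eqr : equator d globe grid by move=> j; apply/dartP; apply: East; lia.
have rl x : row x <= 2 * d by rewrite -H_def row_le.
have sp j : grid (2 * d) j = grid (2 * d) 0 by rewrite -H_def gridH.
have ec i j : i < 2 * d -> globe (grid i j) (grid i.+1 j).
  by rewrite -H_def => iH; apply/dartP; apply: Down.
have big : 2 * d <= #|'I_n|.
  by rewrite card_ord n_def A_def m_def H_def; nia.
eexists; eexists; split.
  exact: (dist_uv d_gt0 globe_sym globe_polar eqr period col_c col_lt lip).
exists (sphere_rule d grid); split; first exact: sphere_rule_valid.
move=> R R_big ks1 ks2 ks3.
exact: (sphere_kpr d_gt0 globe_sym globe_polar rl sp ec eqr period col_c col_lt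
  lip big ks1 ks2 ks3 R_big).
Qed.

End Globe.

Theorem theorem1 :
  forall n d : nat, 1 <= d -> 9 * d ^ 2 <= n ->
  exists e : rel 'I_n,
    simple_graph e /\ connected_graph e /\ planar_connected e /\
    exists u v : 'I_n, is_dist e u v d /\
    exists rule : {set 'I_n} -> rel 'I_n -> 'I_n, valid_rule rule /\
      forall R : nat, 2 * d < R ->
      forall ks1 ks2 ks3 : {set 'I_n} -> 'I_R,
        connect (kpr R rule ks1 ks2 ks3 e) u v.
Proof.
move=> n d d_gt0 n_big.
(* The poles and rings take [4 * d ^ 2 + 1] vertices, at most [9 * d ^ 2]; the surplus becomes
   leaves. *)
have n_def : n = (2 * d).-1 * (2 * d).+1 + 2 + (n - ((2 * d).-1 * (2 * d).+1 + 2)).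
  by rewrite subnKC //; move: n_big; rewrite -mulnn; nia.
exists (@globe d _ n _ _ _ d_gt0 erefl erefl erefl n_def).
split; first exact: globe_simple.
split; first exact: globe_connected.
split; first exact: globe_planar.
exact: globe_kpr.
Qed.
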